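(* Let $m\geq 0$ and $k\geq m+2$ be integers, let $S=\{0,1,\dots,m\}$, and let $G=J_S(3k-2m-1,k)$. Let $C$ be the set of vertices $c$ of $G$ with $\{1,\dots,k-1\}\subset c$. Then $C$ is a (Godsil–McKay) switching set in $G$.
   Context: For integers $n\geq k\geq 2$ and $S\subseteq\{0,1,\dots,k-1\}$, $J_S(n,k)$ is the graph whose vertices are the $k$-subsets of $[n]=\{1,\dots,n\}$, two $k$-subsets $A,B$ being adjacent if $|A\cap B|\in S$. A subset $C$ of the vertex set of a graph $G$ is a (Godsil–McKay) switching set if (1) any two vertices of $C$ have the same number of neighbours in $C$, and (2) every vertex of $G$ not in $C$ is adjacent to exactly $0$, $|C|/2$ or $|C|$ vertices of $C$. *)

(* Defs.v *)
From mathcomp Require Import all_boot.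

Set Implicit Arguments.
Unset Strict Implicit.
Unset Printing Implicit Defensive.

Record sgraph := SGraph {
  vertex :> finType;
  adj : rel vertex;
  adj_sym : symmetric adj;
  adj_irrefl : irreflexive adj
}.

Definition nb_neighbours (G : sgraph) (x : G) (C : {set G}) : nat :=
  #|[set y in C | adj x y]|.

(* The value |C|/2 is the exact half: it is never attained when #|C| is odd. *)
Definition switching_set (G : sgraph) (C : {set G}) : Prop :=
  (forall x y, x \in C -> y \in C -> nb_neighbours x C = nb_neighbours y C) /\
  (forall x, x \notin C ->
     [\/ nb_neighbours x C = 0,
         (nb_neighbours x C).*2 = #|C| |
         nb_neighbours x C = #|C|]).

(* The ground set [n] = {1, ..., n} is 'I_n, with i : 'I_n standing for the
   integer i.+1. *)
Definition ksubset (n k : nat) : finType := {A : {set 'I_n} | #|A| == k}.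

Definition J_adj (n k : nat) (S : {set 'I_k}) (A B : ksubset n k) : bool :=
  [exists s in S, #|val A :&: val B| == s].

Lemma J_adj_sym (n k : nat) (S : {set 'I_k}) : symmetric (@J_adj n k S).
Proof. by move=> A B; rewrite /J_adj setIC. Qed.

(* Irreflexivity holds because every element of S is less than k. *)
Lemma J_adj_irrefl (n k : nat) (S : {set 'I_k}) : irreflexive (@J_adj n k S).
Proof.
move=> A; apply/negbTE/existsP => -[s /andP[_]].
by rewrite setIid (eqP (valP A)) => /eqP E; move: (ltn_ord s); rewrite -E ltnn.
Qed.

Definition J (n k : nat) (S : {set 'I_k}) : sgraph :=
  SGraph (@J_adj_sym n k S) (@J_adj_irrefl n k S).

Definition initial_segment (n j : nat) : {set 'I_n} :=
  [set i : 'I_n | 1 <= i.+1 <= j].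

(* Main.v *)
(* Write K = {1, ..., k-1}. The members of C are the sets v |: K with v outside K,
   so #|C| = n - (k - 1) = 2 (k - m), and a k-subset x meets v |: K in
   t + [v \in x] points, where t = #|x :&: K|. Hence x is adjacent to all of C if
   t < m and to none of C if t > m, the latter covering the members of C. If t = m,
   then x is adjacent to v |: K exactly when v avoids x, and x covers k - m of the
   2 (k - m) points outside K. *)
Require Import Defs.
From mathcomp Require Import all_boot zify.

Lemma card_initial_segment (n j : nat) : j <= n -> #|initial_segment n j| = j.
Proof.
move=> le_jn; have -> : initial_segment n j = widen_ord le_jn @: [set: 'I_j].
  (* Since [i] stands for the integer [i.+1], the bound [1 <= i.+1 <= j] computes to [i < j]. *)
  apply/setP=> i; rewrite inE /=; apply/idP/imsetP => [lt_ij|[u _ ->]].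
    by exists (Ordinal lt_ij); rewrite ?inE //; apply: val_inj.
  exact: (ltn_ord u).
rewrite card_imset ?cardsT ?card_ord // => u v /(congr1 val) /= uv.
exact: val_inj.
Qed.

Lemma superset_add1 (n k : nat) (K : {set 'I_n}) (c : ksubset n k) :
  #|K|.+1 = k -> K \subset val c -> exists2 v, v \notin K & val c = v |: K.
Proof.
move=> cardK sKc; have /cards1P[v defD] : #|val c :\: K| == 1.
  by rewrite cardsDS // (eqP (valP c)) -cardK subSnn.
exists v; first by have := set11 v; rewrite -defD inE => /andP[].
by rewrite -defD -[LHS](setID _ K) (setIidPr sKc) setUC.
Qed.

(** Adding a point of [B] to [K] is a bijection onto these supersets: as [B] avoids [K], it is
    injective and its values have size [k]. With [B] equal to [~: K] this counts [C]; with
    [~: (val x :|: K)] it counts the neighbours of [x] in [C] when [t = m]. *)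
Lemma card_supersets_add1 (n k : nat) (K B : {set 'I_n}) :
  #|K|.+1 = k -> [disjoint B & K] ->
  #|[set c : ksubset n k | (K \subset val c) && (val c :\: K \subset B)]| = #|B|.
Proof.
move=> cardK dBK; rewrite -(card_imset _ val_inj).
have notinK v : v \in B -> v \notin K by move=> /(disjointFr dBK) ->.
rewrite -[RHS](card_in_imset (f := fun v => v |: K)); last first.
  move=> u v /notinK uK _ eq_uv; have := setU11 u K.
  by rewrite eq_uv !inE (negPf uK) orbF => /eqP.
apply: eq_card => A; apply/imsetP/imsetP => [[c]|[v vB ->]].
  rewrite inE => /andP[/(superset_add1 _ _ _ _ cardK)[v vK defc] sDB] ->; exists v => //.
  by apply: (subsetP sDB); rewrite defc !inE eqxx vK.
have card_vK : #|v |: K| == k by rewrite cardsU1 notinK // -cardK.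
exists (exist _ (v |: K) card_vK) => //; rewrite inE /= subsetUr /=.
by apply/subsetP=> u; rewrite !inE => /andP[/negPf->]; rewrite orbF => /eqP->.
Qed.

Lemma J_adj_initial (m n k : nat) (x c : ksubset n k) : m < k ->
  J_adj [set s : 'I_k | s <= m] x c = (#|val x :&: val c| <= m).
Proof.
move=> lt_mk; apply/existsP/idP => [[s]|le_xcm].
  by rewrite inE => /andP[le_sm /eqP->].
(* The size of the meet is at most [m < k], so it is an element of ['I_k]. *)
by exists (Ordinal (leq_ltn_trans le_xcm lt_mk)); rewrite inE /= le_xcm eqxx.
Qed.

Theorem theorem6 (m k : nat) (hk : m + 2 <= k) :
  let n := 3 * k - 2 * m - 1 in
  let S := [set s : 'I_k | s <= m] in
  let G := J n S in
  let C : {set G} := [set c : ksubset n k | initial_segment n (k - 1) \subset val c] in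
  switching_set C.
Proof.
move=> n S G C; set K := initial_segment n (k - 1) in C *.
have cardK : #|K| = k - 1 by apply: card_initial_segment; rewrite /n; lia.
(* From here on only the size of [K] matters. *)
clearbody K.
have cardK1 : #|K|.+1 = k by lia.
have lt_mk : m < k by lia.
have card_meet (x c : G) : c \in C -> exists2 v, val c :\: K = [set v] &
    #|val x :&: val c| = (v \in val x) + #|val x :&: K|.
  rewrite inE => /(superset_add1 _ _ _ _ cardK1)[v vK ->]; exists v.
    apply/setP=> u; rewrite !inE; case: (eqVneq u v) => [->|_] /=.
      by rewrite vK.
    by case: (u \in K).
  rewrite setIUr; case: (boolP (v \in val x)) => vx.
    have -> : val x :&: [set v] = [set v] by apply/setIidPr; rewrite sub1set.
    by rewrite cardsU1 inE (negPf vK) andbF.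
  have -> : val x :&: [set v] = set0 by apply/eqP; rewrite setI_eq0 disjoint_sym disjoints1.
  by rewrite set0U.
have nb0 (x : G) : m < #|val x :&: K| -> nb_neighbours x C = 0.
  move=> lt_mt; apply/eqP; rewrite cards_eq0 -subset0; apply/subsetP=> c.
  rewrite inE => /andP[/(card_meet x)[v _ eq_xc]].
  by rewrite /= J_adj_initial // eq_xc; lia.
(* Here [t = k - 1], which exceeds [m] because [m + 2 <= k]; so [C] is an independent set. *)
have nbC0 (x : G) : x \in C -> nb_neighbours x C = 0.
  by rewrite inE => sKx; apply: nb0; rewrite (setIidPr sKx); lia.
split=> [x y xC yC|x _]; first by rewrite !nbC0.
case: (ltngtP #|val x :&: K| m) => [lt_tm|/nb0|eq_tm]; last 2 first.
- by constructor 1.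
- constructor 2.
  have -> : nb_neighbours x C = #|~: (val x :|: K)|.
    rewrite -(card_supersets_add1 _ _ _ _ cardK1); last first.
      by rewrite disjoints_subset setCS subsetUr.
    apply: eq_card => c; rewrite [LHS]inE [RHS]inE [c \in C]inE.
    apply: andb_id2l => sKc; have cC : c \in C by rewrite inE.
    have [v defD eq_xc] := card_meet x c cC.
    rewrite /= J_adj_initial // eq_xc eq_tm defD sub1set !inE.
    have /setDP[_ /negPf->] : v \in val c :\: K by rewrite defD set11.
    by case: (v \in val x); rewrite /= ?ltnn ?leqnn; lia.
  have -> : #|C| = #|~: K|.
    rewrite -(card_supersets_add1 _ _ _ _ cardK1); last first.
      by rewrite disjoints_subset.
    apply: eq_card => c; rewrite !inE.
    by rewrite setDE subsetIr andbT.
  (* By inclusion-exclusion [val x :|: K] has [2k - 1 - m] points. Its complement has [k - m], half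
     of the [n - (k - 1) = 2(k - m)] points outside [K]. *)
  have := cardsC K; have := cardsC (val x :|: K); rewrite cardsU card_ord.
  by rewrite eq_tm cardK (eqP (valP x)) /n; lia.
(* Every meet with a member of [C] has at most [t + 1 <= m] points. *)
- constructor 3; apply: eq_card => c; rewrite inE.
  apply: andb_idr => /(card_meet x)[v _ eq_xc].
  by rewrite /= J_adj_initial // eq_xc; lia.
Qed.
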